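(* Let $G_I$ be the icosahedron graph, i.e. the graph formed by the $12$ vertices and $30$ edges of the regular icosahedron. Then the (divisorial) gonality of $G_I$ satisfies $\operatorname{gon}(G_I)=9$.
   Context: Graphs are finite, connected and undirected, without loops. Explicitly, the icosahedron graph is the graph with vertices $t,s,u_i,w_i$ ($i\in\mathbb{Z}/5$) and edges $tu_i$, $u_iu_{i+1}$, $u_iw_i$, $u_iw_{i+1}$, $w_iw_{i+1}$, $sw_i$ for all $i\in\mathbb{Z}/5$ (a $5$-regular simple graph). A divisor on a graph $G$ is a function $D:V(G)\to\mathbb{Z}$ (an assignment of an integer number of chips to each vertex); its degree is $\deg(D)=\sum_v D(v)$, and it is debt-free if $D(v)\ge 0$ for all $v$. Firing a vertex $v$ changes $D$ by moving one chip from $v$ to the other endpoint along each edge incident to $v$ (so $v$ loses $\operatorname{val}(v)$ chips, where $\operatorname{val}(v)$ is the number of edges incident to $v$). Two divisors are equivalent if one can be obtained from the other by a finite sequence of chip-firing moves (debt is allowed at intermediate stages). The gonality $\operatorname{gon}(G)$ is the minimum integer $N$ such that there exists a divisor $D$ of degree $N$ on $G$ with the property that for every vertex $q\in V(G)$, the divisor obtained from $D$ by removing one chip from $q$ is equivalent to a debt-free divisor. *)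

(* Defs.v *)
From HB Require Import structures.
From mathcomp Require Import all_boot all_order all_algebra.

Set Implicit Arguments.
Unset Strict Implicit.
Unset Printing Implicit Defensive.

Import GRing.Theory.
Local Open Scope ring_scope.

(* Parallel edges are allowed: [mult x y] is the number of edges joining
   x and y. *)
Record graph := Graph {
  vertex :> finType;
  mult : vertex -> vertex -> nat;
  mult_sym : forall x y, mult x y = mult y x;
  mult_loopless : forall x, mult x x = 0%N;
  vertex_nonempty : (0 < #|vertex|)%N;
  graph_connected : forall x y, connect (fun u v => (0 < mult u v)%N) x y
}.

Definition valence (G : graph) (v : G) : nat := (\sum_(w : G) mult v w)%N.

Definition divisor (G : graph) := {ffun G -> int}.

Definition deg (G : graph) (D : divisor G) : int := \sum_(v : G) D v.

Definition debt_free (G : graph) (D : divisor G) : Prop :=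
  forall v : G, 0 <= D v.

Definition fire (G : graph) (D : divisor G) (v : G) : divisor G :=
  [ffun w => if w == v then D v - (valence v)%:Z else D w + (mult v w)%:Z].

(* This relation is symmetric: firing every vertex once leaves a divisor
   unchanged, so a firing at v is undone by firing all the other vertices. *)
Definition equivalent (G : graph) (D D' : divisor G) : Prop :=
  exists s : seq G, D' = foldl (@fire G) D s.

Definition remove_chip (G : graph) (D : divisor G) (q : G) : divisor G :=
  [ffun v => if v == q then D v - 1 else D v].

Definition positive_rank (G : graph) (D : divisor G) : Prop :=
  forall q : G, exists D' : divisor G,
    equivalent (remove_chip D q) D' /\ debt_free D'.

Definition is_gonality (G : graph) (N : int) : Prop :=
  (exists D : divisor G, deg D = N /\ positive_rank D) /\
  (forall M : int,
     (exists D : divisor G, deg D = M /\ positive_rank D) -> N <= M).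

Inductive icosa_vertex : Type :=
  | ico_t | ico_s | ico_u of 'Z_5 | ico_w of 'Z_5.

Definition icosa_code (x : icosa_vertex) : bool + 'Z_5 + 'Z_5 :=
  match x with
  | ico_t => inl (inl true)
  | ico_s => inl (inl false)
  | ico_u i => inl (inr i)
  | ico_w i => inr i
  end.

Definition icosa_decode (c : bool + 'Z_5 + 'Z_5) : icosa_vertex :=
  match c with
  | inl (inl b) => if b then ico_t else ico_s
  | inl (inr i) => ico_u i
  | inr i => ico_w i
  end.

Lemma icosa_codeK : cancel icosa_code icosa_decode.
Proof. by case. Qed.

HB.instance Definition _ := Finite.copy icosa_vertex (can_type icosa_codeK).

(* Each edge is listed in one orientation. *)
Definition icosa_arc (x y : icosa_vertex) : bool :=
  match x, y with
  | ico_t, ico_u _ => true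
  | ico_u i, ico_u j => j == i + 1
  | ico_u i, ico_w j => (j == i) || (j == i + 1)
  | ico_w i, ico_w j => j == i + 1
  | ico_s, ico_w _ => true
  | _, _ => false
  end.

Definition icosa_mult (x y : icosa_vertex) : nat :=
  icosa_arc x y || icosa_arc y x.

Lemma icosa_mult_sym x y : icosa_mult x y = icosa_mult y x.
Proof. by rewrite /icosa_mult orbC. Qed.

Lemma icosa_mult_loopless x : icosa_mult x x = 0%N.
Proof.
by case: x => [||i|i] //; rewrite /icosa_mult /= orbb -{1}[i]addr0
  (inj_eq (addrI i)).
Qed.

Lemma icosa_nonempty : (0 < #|{: icosa_vertex}|)%N.
Proof. by apply/card_gt0P; exists ico_t. Qed.

Lemma icosa_connected x y :
  connect (fun u v => (0 < icosa_mult u v)%N) x y.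
Proof.
set e := (fun u v => _).
have e_sym : connect_sym e.
  by apply: sym_connect_sym => u v; rewrite /e icosa_mult_sym.
have tu i : connect e ico_t (ico_u i) by apply: connect1.
have tw i : connect e ico_t (ico_w i).
  by apply: connect_trans (tu i) (connect1 _); rewrite /e /icosa_mult /= eqxx.
have tx z : connect e ico_t z.
  by case: z => // ; apply: connect_trans (tw 0) (connect1 _).
by apply: connect_trans (tx y); rewrite e_sym.
Qed.

Definition icosahedron : graph :=
  Graph icosa_mult_sym icosa_mult_loopless icosa_nonempty icosa_connected.

(* Main.v *)
(** Upper bound: one chip on every vertex outside an independent set.

    Lower bound: if [D] is debt-free of positive rank and [D q = 0], then some
    nonempty vertex set [A] avoiding [q] can be fired without creating debt, so
    the edge cut of [A] is at most [deg D]. On the icosahedron a cut of size at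
    most 8 isolates one or two vertices. Let [deg D <= 8]. Firing such an [A],
    if necessary, puts chips on at least five vertices; then a legal [A] can
    only be the complement of one or two vertices. Its boundary carries no zero
    of [D], so every zero of [D] has at most one neighbour that is also a zero,
    and none if [D] has only four zeros. But four vertices of the icosahedron
    are never independent, and among five some vertex has two neighbours. *)

From mathcomp Require Import all_boot all_order all_algebra.
From mathcomp Require Import zify ring.
Require Import Defs.

Set Implicit Arguments.
Unset Strict Implicit.
Unset Printing Implicit Defensive.

Import Order.TTheory GRing.Theory Num.Theory.
Local Open Scope ring_scope.

(** * Firing scripts, the Laplacian and equivalence of divisors *)

(** The net gain of [w] when each [v] is fired [f v] times; negative values mean borrowing. *)
Definition lap (G : graph) (f : G -> int) (w : G) : int :=
  \sum_v (mult v w)%:Z * (f v - f w).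

Lemma eq_lap (G : graph) (f g : G -> int) : f =1 g -> lap f =1 lap g.
Proof. by move=> fg w; apply: eq_bigr => v _; rewrite !fg. Qed.

Lemma lapD (G : graph) (f g : G -> int) w :
  lap (fun v => f v + g v) w = lap f w + lap g w.
Proof. by rewrite /lap -big_split /=; apply: eq_bigr => v _; ring. Qed.

Lemma lapN (G : graph) (f : G -> int) w : lap (fun v => - f v) w = - lap f w.
Proof. by rewrite /lap -sumrN; apply: eq_bigr => v _; ring. Qed.

Lemma lap_shift (G : graph) (f : G -> int) c w :
  lap (fun v => f v + c) w = lap f w.
Proof. by apply: eq_bigr => v _; ring. Qed.

Lemma sum_lap (G : graph) (f : G -> int) : \sum_w lap f w = 0.
Proof.
suff: \sum_w lap f w = - \sum_w lap f w by lia.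
rewrite {1}exchange_big -sumrN; apply: eq_bigr => v _.
by rewrite -sumrN; apply: eq_bigr => w _; rewrite mult_sym; ring.
Qed.

Lemma lap_delta (G : graph) (v w : G) :
  lap (fun x => (x == v)%:Z) w =
  if w == v then - (valence v)%:Z else (mult v w)%:Z.
Proof.
rewrite /lap (bigD1 v) //= eqxx; case: (eqVneq w v) => [->|nwv].
  have -> : valence v = (\sum_(x | x != v) mult v x)%N.
    by rewrite /valence (bigD1 v) //= mult_loopless.
  rewrite subrr mulr0 add0r (big_morph Posz PoszD (erefl _)) -sumrN.
  by apply: eq_bigr => x /negPf->; rewrite mult_sym sub0r mulrN1.
rewrite subr0 mulr1 big1 ?addr0 // => x /negPf->.
by rewrite subrr mulr0.
Qed.

Lemma fireE (G : graph) (D : divisor G) v w :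
  fire D v w = D w + lap (fun x => (x == v)%:Z) w.
Proof. by rewrite ffunE lap_delta; case: eqP => [->|]. Qed.

Lemma foldl_fireE (G : graph) (D : divisor G) s w :
  foldl (@fire G) D s w = D w + lap (fun x => (count_mem x s)%:Z) w.
Proof.
elim: s D => [|v s IHs] D /=.
  by rewrite /lap big1 ?addr0 // => x _; rewrite mulr0.
rewrite IHs fireE -addrA -lapD; congr (_ + _).
by apply: eq_lap => x; rewrite PoszD eq_sym.
Qed.

(** Firing sequences realise only nonnegative scripts, but adding a constant to a script leaves its
    Laplacian unchanged, so every integer script is realised. *)
Lemma equivalentP (G : graph) (D D' : divisor G) :
  equivalent D D' <-> exists f : G -> int, forall w, D' w = D w + lap f w.
Proof.
split=> [[s ->]|[f D'E]]; first by eexists => w; apply: foldl_fireE.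
pose c : int := \sum_v `|f v|.
have f_ge0 v : 0 <= f v + c.
  rewrite /c (bigD1 v) //= addrA addr_ge0 ?sumr_ge0 //.
  by rewrite -lerBlDl sub0r -normrN ler_norm.
exists (flatten [seq nseq (absz (f v + c)) v | v <- enum G]).
apply/ffunP => w; rewrite foldl_fireE D'E; congr (_ + _).
rewrite -(lap_shift f c); apply: eq_lap => v.
rewrite count_flatten -map_comp sumnE big_map big_enum /= (bigD1 v) //=.
rewrite big1 => [|x nxv]; last by rewrite count_nseq /= (negPf nxv).
by rewrite count_nseq /= eqxx mul1n addn0 gez0_abs.
Qed.

Lemma equivalent_sym (G : graph) (D D' : divisor G) :
  equivalent D D' -> equivalent D' D.
Proof.
case/equivalentP=> f D'E; apply/equivalentP; exists (fun v => - f v) => w.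
by rewrite lapN D'E addrK.
Qed.

Lemma equivalent_trans (G : graph) (D1 D2 D3 : divisor G) :
  equivalent D1 D2 -> equivalent D2 D3 -> equivalent D1 D3.
Proof. by case=> s -> [s' ->]; exists (s ++ s'); rewrite foldl_cat. Qed.

Lemma deg_equivalent (G : graph) (D D' : divisor G) :
  equivalent D D' -> deg D' = deg D.
Proof.
case/equivalentP=> f D'E; rewrite /deg (eq_bigr _ (fun w _ => D'E w)).
by rewrite big_split /= sum_lap addr0.
Qed.

Lemma remove_chipE (G : graph) (D : divisor G) q v :
  remove_chip D q v = D v - (v == q)%:Z.
Proof. by rewrite ffunE; case: eqP; rewrite ?subr0. Qed.

Lemma equivalent_remove_chip (G : graph) (D D' : divisor G) q :
  equivalent D D' -> equivalent (remove_chip D q) (remove_chip D' q).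
Proof.
case/equivalentP=> f D'E; apply/equivalentP; exists f => w.
by rewrite !remove_chipE D'E addrAC.
Qed.

Lemma positive_rank_equivalent (G : graph) (D D' : divisor G) :
  equivalent D D' -> positive_rank D -> positive_rank D'.
Proof.
move=> eqD rkD q; have [E [eqE E_ge0]] := rkD q.
exists E; split=> //; apply: equivalent_trans eqE.
exact/equivalent_sym/equivalent_remove_chip.
Qed.

(** Apply to [D] the script that clears the debt of [D] minus a chip at some [q]; the chip kept at
    [q] only helps. *)
Lemma positive_rank_debt_free (G : graph) (D : divisor G) :
  positive_rank D -> exists D', equivalent D D' /\ debt_free D'.
Proof.
have /card_gt0P[q _] := @vertex_nonempty G.
case/(_ q)=> E [/equivalentP[f EE] E_ge0].
exists [ffun w => D w + lap f w]; split.
  by apply/equivalentP; exists f => w; rewrite ffunE.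
move=> w; rewrite ffunE; have := E_ge0 w; rewrite EE remove_chipE.
by case: (w == q) => /=; lia.
Qed.

(** * Firing vertex sets without creating debt *)

Definition outdeg (G : graph) (A : {set G}) (v : G) : nat :=
  (\sum_(w | w \notin A) mult v w)%N.

Lemma mult_le_outdeg (G : graph) (A : {set G}) v w :
  w \notin A -> (mult v w <= outdeg A v)%N.
Proof. by move=> wA; rewrite /outdeg (bigD1 w) //= leq_addr. Qed.

Definition cut (G : graph) (A : {set G}) : nat := (\sum_(v in A) outdeg A v)%N.

Definition boundary (G : graph) (A : {set G}) : {set G} :=
  [set v in A | (0 < outdeg A v)%N].

Definition legal (G : graph) (D : divisor G) (A : {set G}) : Prop :=
  forall v, v \in A -> (outdeg A v)%:Z <= D v.

(* Among the scripts realising an equivalence of [D - q] with a debt-free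
   divisor, the vertices fired most often form such a set. *)
Lemma exists_legal (G : graph) (D : divisor G) q :
  positive_rank D -> D q = 0 ->
  exists A : {set G}, [/\ A != set0, q \notin A & legal D A].
Proof.
move=> /(_ q)[E [/equivalentP[f EE] E_ge0]] Dq0.
pose x := [arg max_(y > q) f y]%O.
have f_le y : f y <= f x.
  by rewrite /x; case: Order.TotalTheory.arg_maxP => // z _; apply.
have lap_le v : f v = f x ->
    lap f v <= - (outdeg [set y | f y == f x] v)%:Z.
  move=> fv; rewrite /outdeg /lap (bigID (mem [set y | f y == f x])) /=.
  rewrite big1 ?add0r; last first.
    by move=> y; rewrite inE fv => /eqP->; rewrite subrr mulr0.
  rewrite (big_morph Posz PoszD (erefl _)) -sumrN; apply: ler_sum => y.
  rewrite inE fv => fy; have := f_le y; rewrite mult_sym; nia.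
exists [set y | f y == f x]; split.
- by apply/set0Pn; exists x; rewrite inE.
- apply/negP; rewrite inE => /eqP fq; have := E_ge0 q; have := lap_le _ fq.
  by rewrite EE remove_chipE eqxx Dq0; lia.
move=> v; rewrite inE => /eqP fv; have := E_ge0 v; have := lap_le _ fv.
by rewrite EE remove_chipE; case: (v == q); lia.
Qed.

Lemma lap_set (G : graph) (A : {set G}) w :
  lap (fun v => (v \in A)%:Z) w =
  if w \in A then - (outdeg A w)%:Z else (outdeg (~: A) w)%:Z.
Proof.
rewrite /lap /outdeg; case: ifP => wA.
  rewrite (bigID (mem A)) /= big1 ?add0r => [|v ->]; last first.
    by rewrite subrr mulr0.
  rewrite (big_morph Posz PoszD (erefl _)) -sumrN.
  by apply: eq_bigr => v /negPf->; rewrite mult_sym sub0r mulrN1.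
rewrite (bigID (mem A)) /= addrC big1 ?add0r => [|v /negPf->]; last first.
  by rewrite subrr mulr0.
rewrite (big_morph Posz PoszD (erefl _)); apply: eq_big => v.
  by rewrite inE negbK.
by move=> ->; rewrite mult_sym subr0 mulr1.
Qed.

(** Members of [A] can afford their outgoing edges, and each outside vertex with a neighbour in [A]
    receives a chip. *)
Lemma fire_legal (G : graph) (D : divisor G) (A : {set G}) :
  debt_free D -> legal D A ->
  exists D', [/\ equivalent D D', debt_free D' &
    forall w, w \in boundary (~: A) -> D' w != 0].
Proof.
move=> D_ge0 legA.
exists [ffun w => D w + lap (fun v => (v \in A)%:Z) w]; split.
- by apply/equivalentP; eexists => w; rewrite ffunE.
- move=> w; rewrite ffunE lap_set; have := D_ge0 w.
  by case: ifP => [/legA|_]; lia.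
move=> w; rewrite !inE ffunE lap_set => /andP[/negPf-> ?].
by have := D_ge0 w; lia.
Qed.

(** Vertex by vertex: the chips of [D] pay for the cut, and each support vertex off the boundary
    holds one chip more; the boundary term corrects for support vertices that may spend
    everything. *)
Lemma legal_budget (G : graph) (D : divisor G) (A : {set G}) :
  debt_free D -> legal D A ->
  (cut A + #|[set v | D v != 0]|)%:Z <= deg D + #|boundary A|%:Z.
Proof.
move=> D_ge0 legA.
rewrite /cut -!sum1_card !(big_mkcond (fun v => v \in _)) /=.
rewrite PoszD !(big_morph Posz PoszD (erefl _)) /deg -!big_split /=.
apply: ler_sum => v _; rewrite !inE; have := D_ge0 v.
case: (boolP (v \in A)) => [/legA|_] /=; case: (eqVneq (D v) 0) => /=; try lia.
by case: (ltnP 0 (outdeg A v)); lia.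
Qed.

Lemma cut_le_deg (G : graph) (D : divisor G) (A : {set G}) :
  debt_free D -> legal D A -> (cut A)%:Z <= deg D.
Proof.
move=> D_ge0 legA; rewrite /cut big_mkcond (big_morph Posz PoszD (erefl _)).
by apply: ler_sum => v _; case: ifP => [/legA|_].
Qed.

Lemma boundary_neq0 (G : graph) (D : divisor G) (A : {set G}) :
  legal D A -> boundary A \subset [set v | D v != 0].
Proof.
by move=> legA; apply/subsetP => v; rewrite !inE => /andP[/legA]; lia.
Qed.

Lemma positive_rank_independent (G : graph) (I : {set G}) :
  (forall v : G, 0 < valence v)%N ->
  (forall v w, v \in I -> w \in I -> mult v w = 0%N) ->
  (forall v w : G, mult v w <= 1)%N ->
  positive_rank [ffun v => (v \notin I)%:Z].
Proof.
move=> val_gt0 indI simpleG q; set D := finfun _.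
case: (boolP (q \in I)) => qI; last first.
  exists (remove_chip D q); split; first by exists [::].
  move=> v; rewrite remove_chipE ffunE.
  by case: (eqVneq v q) => [->|_]; rewrite ?qI //=; lia.
(* Let [q] borrow once: its neighbours lie outside [I], and each gives up at most its single
   chip. *)
exists [ffun w => remove_chip D q w + lap (fun v => - (v == q)%:Z) w]; split.
  by apply/equivalentP; eexists => w; rewrite ffunE.
move=> w; rewrite ffunE lapN lap_delta remove_chipE ffunE.
case: eqP => [->|_]; first by rewrite qI /=; have := val_gt0 q; lia.
case: (boolP (w \in I)) => wI /=; first by rewrite indI.
by have := simpleG q w; lia.
Qed.

(** * Exhaustive computation over the vertex sets of the icosahedron *)

Definition icosa_enum : seq icosahedron :=
  [:: ico_t, ico_s & [seq ico_u (inZp k) | k <- iota 0 5]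
                     ++ [seq ico_w (inZp k) | k <- iota 0 5]].

Definition icosa_nth (i : nat) : icosahedron := nth ico_t icosa_enum i.

Lemma mem_icosa_enum v : v \in icosa_enum.
Proof.
by case: v => [||i|i] //; rewrite 2!in_cons mem_cat -[i]valZpK;
  rewrite map_f ?orbT // mem_iota ltn_ord.
Qed.

Lemma perm_icosa_enum : perm_eq (index_enum icosahedron) icosa_enum.
Proof.
apply: uniq_perm; [exact: index_enum_uniq | by vm_compute |] => v.
by rewrite mem_index_enum mem_icosa_enum.
Qed.

Lemma icosa_nthP v : exists2 i, i \in iota 0 12 & v = icosa_nth i.
Proof.
exists (index v icosa_enum).
  by rewrite mem_iota; have := mem_icosa_enum v; rewrite -index_mem.
by rewrite /icosa_nth nth_index ?mem_icosa_enum.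
Qed.

Lemma sum_icosa (P : pred icosahedron) (F : icosahedron -> nat) :
  (\sum_(v | P v) F v =
   \sum_(i <- iota 0 12 | P (icosa_nth i)) F (icosa_nth i))%N.
Proof. by rewrite (perm_big _ perm_icosa_enum) (big_nth ico_t). Qed.

Lemma card_icosa (A : {set icosahedron}) :
  #|A| = count (fun i => icosa_nth i \in A) (iota 0 12).
Proof. by rewrite -sum1_card sum_icosa sum1_count. Qed.

Lemma card_icosahedron : #|icosahedron| = 12%N.
Proof.
rewrite -cardsT card_icosa (eq_count (a2 := predT)) ?count_predT // => i.
by rewrite inE.
Qed.

Definition icosa_adj : seq (seq nat) := Eval vm_compute in
  [seq [seq j <- iota 0 12 | (0 < mult (icosa_nth i) (icosa_nth j))%N]
     | i <- iota 0 12].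

Lemma icosa_adjE i : i \in iota 0 12 ->
  nth [::] icosa_adj i =
  [seq j <- iota 0 12 | (0 < mult (icosa_nth i) (icosa_nth j))%N].
Proof. by move=> i12; apply/eqP; move: i i12; apply/allP; vm_compute.
Qed.

Lemma icosa_simple (v w : icosahedron) : (mult v w <= 1)%N.
Proof. exact: leq_b1. Qed.

(* A set of vertices is encoded by the sequence of its 12 membership bits, on
   which the quantities below can be evaluated. *)
Definition bits (A : {set icosahedron}) : seq bool :=
  [seq icosa_nth i \in A | i <- iota 0 12].

Definition bits_outdeg (m : seq bool) (i : nat) : nat :=
  count (fun j => ~~ nth false m j) (nth [::] icosa_adj i).

Definition bits_cut (m : seq bool) : nat :=
  sumn [seq bits_outdeg m i | i <- iota 0 12 & nth false m i].

Definition bits_boundary (m : seq bool) : nat :=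
  count (fun i => nth false m i && (0 < bits_outdeg m i)%N) (iota 0 12).

Lemma nth_bits A i :
  i \in iota 0 12 -> nth false (bits A) i = (icosa_nth i \in A).
Proof.
by rewrite mem_iota => i12; rewrite (nth_map 0%N) ?size_iota ?nth_iota.
Qed.

Lemma bitsC A : bits (~: A) = map negb (bits A).
Proof. by rewrite -map_comp; apply: eq_map => i; rewrite /= inE. Qed.

Lemma bits_card A : count id (bits A) = #|A|.
Proof. by rewrite count_map card_icosa. Qed.

Lemma bits_outdegE A i : i \in iota 0 12 ->
  bits_outdeg (bits A) i = outdeg A (icosa_nth i).
Proof.
move=> i12; rewrite /bits_outdeg icosa_adjE // count_filter /outdeg sum_icosa.
rewrite -sum1_count big_mkcond [RHS]big_mkcond; apply: eq_big_seq => j j12 /=.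
rewrite nth_bits //; have := icosa_simple (icosa_nth i) (icosa_nth j).
by case: (_ \in A) => //=; case: icosa_mult => [|[|]].
Qed.

Lemma bits_cutE A : bits_cut (bits A) = cut A.
Proof.
rewrite /bits_cut /cut sum_icosa sumnE big_map big_filter.
rewrite big_mkcond [RHS]big_mkcond; apply: eq_big_seq => i i12.
by rewrite nth_bits // bits_outdegE.
Qed.

Lemma bits_boundaryE A : bits_boundary (bits A) = #|boundary A|.
Proof.
rewrite /bits_boundary card_icosa; apply: eq_in_count => i i12 /=.
by rewrite nth_bits // bits_outdegE // inE.
Qed.

Fixpoint bitseqs (n : nat) : seq (seq bool) :=
  if n is n'.+1 then
    map (cons true) (bitseqs n') ++ map (cons false) (bitseqs n')
  else [:: [::]].

Lemma mem_bitseqs m : m \in bitseqs (size m).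
Proof.
elim: m => //= b m IHm; rewrite mem_cat.
by case: b; rewrite map_f ?orbT.
Qed.

Lemma bits_all (p : pred (seq bool)) A : all p (bitseqs 12) -> p (bits A).
Proof. by move/allP; apply; rewrite (mem_bitseqs (bits A)). Qed.

(** Checked on all 4096 subsets. The first item spreads the chips of a divisor with small support.
    The others are fed by [legal_budget] in degree at most 8: the slack 3 is 8 - 5, for a support of
    at least five vertices, and the slack 0 is 8 - 8. *)
Lemma icosa_cut (A : {set icosahedron}) :
  A != set0 -> A != setT -> (cut A <= 8)%N ->
  [/\ (#|boundary A| <= 4)%N -> (5 <= #|boundary (~: A)|)%N,
      (cut A <= #|boundary A| + 3)%N -> (#|~: A| <= 2)%N
    & (cut A <= #|boundary A|)%N -> (#|~: A| <= 1)%N].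
Proof.
rewrite -cards_eq0 -(inj_eq (can_inj (@setCK _))) setCT -[_ == set0]cards_eq0.
rewrite -!bits_boundaryE -!bits_card -bits_cutE bitsC => A0 AT cutA.
pose p m := let n := bits_cut m in let b := bits_boundary m in
  let c := count id (map negb m) in
  [|| count id m == 0, c == 0, 8 < n |
      [&& (b <= 4) ==> (5 <= bits_boundary (map negb m)),
          (n <= b + 3) ==> (c <= 2) & (n <= b) ==> (c <= 1)]]%N.
have : p (bits A) by apply: bits_all; vm_compute.
rewrite /p /= (negPf A0) (negPf AT) ltnNge cutA /=.
by case/and3P=> /implyP ? /implyP ? /implyP ?.
Qed.

(** Here [outdeg (~: Z) q] counts the neighbours of [q] inside [Z]. The case [k = 1] says that four
    vertices are never independent. *)
Lemma icosa_induced_degree (Z : {set icosahedron}) k :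
  (0 < k <= 2)%N -> (k + 3 <= #|Z|)%N ->
  exists2 q, q \in Z & (k <= outdeg (~: Z) q)%N.
Proof.
move=> k12; rewrite -bits_card => Zk.
pose p m := all (fun k => (k + 3 <= count id m)%N ==>
  has (fun i => nth false m i && (k <= bits_outdeg (map negb m) i)%N)
    (iota 0 12)) [:: 1; 2].
have /allP/(_ k) : p (bits Z) by apply: bits_all; vm_compute.
rewrite Zk -bitsC => /(_ _)/hasP[].
  by case: k k12 {Zk} => [|[|[|]]].
move=> i i12; rewrite nth_bits // bits_outdegE // => /andP[Zi ki].
by exists (icosa_nth i).
Qed.

(** * The lower bound, first for supports of at least five vertices *)

Lemma icosa_no_spread (D : divisor icosahedron) :
  debt_free D -> deg D <= 8 -> (5 <= #|[set v | D v != 0]|)%N ->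
  ~ positive_rank D.
Proof.
move=> D_ge0 degD; set S := [set v | _] => S5 rkD.
have S8 : (#|S| <= 8)%N.
  have leg0 : legal D set0 by move=> v; rewrite inE.
  have := legal_budget D_ge0 leg0; rewrite (_ : boundary set0 = set0).
    by rewrite cards0 -/S; lia.
  by apply/setP => v; rewrite !inE.
have cardZ : (#|~: S| = 12 - #|S|)%N by rewrite cardsCs setCK card_icosahedron.
(* Bounding the number of zeros adjacent to a zero [q] suffices: a support of eight leaves four
   zeros, a smaller one at least five. *)
suff degZ q : q \in ~: S ->
    (outdeg S q <= 1)%N /\ ((8 <= #|S|)%N -> outdeg S q = 0%N).
  case: (leqP 8 #|S|) => S8'.
    have [||q qZ] := @icosa_induced_degree (~: S) 1; first by [].
      by lia.
    by have [_] := degZ q qZ; rewrite setCK; lia.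
  have [||q qZ] := @icosa_induced_degree (~: S) 2; first by [].
    by lia.
  by have [] := degZ q qZ; rewrite setCK; lia.
rewrite !inE negbK => /eqP Dq0.
have [A [A0 qA legA]] := exists_legal rkD Dq0.
have AT : A != setT by apply: contraNneq qA => ->; rewrite inE.
have cutA := cut_le_deg D_ge0 legA.
have budA := legal_budget D_ge0 legA.
rewrite -/S in budA.
have [|_ B2 B1] := icosa_cut A0 AT; first by lia.
(* A neighbour of [q] in [A] pays a chip towards [q], hence is not a zero; so the zeros adjacent to
   [q] all lie in the complement of [A], with [q] itself removed. *)
have leB : (outdeg S q < #|~: A|)%N.
  rewrite (cardsD1 q) inE qA add1n ltnS /outdeg -sum1_card.
  rewrite big_mkcond [leqRHS]big_mkcond; apply: leq_sum => w _.
  case: ifP => //; rewrite !inE negbK => /eqP Dw0.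
  case: (eqVneq w q) => [->|_]; first by rewrite mult_loopless.
  case: (boolP (w \in A)) => [wA|_]; last exact: icosa_simple.
  by have := legA _ wA; have := mult_le_outdeg w qA; rewrite mult_sym Dw0; lia.
split; last by move=> ?; have := B1; lia.
by have := B2; lia.
Qed.

Lemma icosa_positive_rank_deg (D : divisor icosahedron) :
  positive_rank D -> 9 <= deg D.
Proof.
move=> rkD; rewrite leNgt; apply/negP => degD.
have [D1 [eqD1 D1_ge0]] := positive_rank_debt_free rkD.
have rkD1 := positive_rank_equivalent eqD1 rkD.
have degD1 : deg D1 <= 8 by rewrite (deg_equivalent eqD1); lia.
set S := [set v | D1 v != 0].
case: (leqP 5 #|S|) => [S5|S4].
  exact: icosa_no_spread D1_ge0 degD1 S5 rkD1.
have [q] : exists q, q \in ~: S.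
  by apply/set0Pn; rewrite -card_gt0 cardsCs setCK card_icosahedron; lia.
rewrite !inE negbK => /eqP D1q0.
have [A [A0 qA legA]] := exists_legal rkD1 D1q0.
have AT : A != setT by apply: contraNneq qA => ->; rewrite inE.
have cutA := cut_le_deg D1_ge0 legA.
have [|dA _ _] := icosa_cut A0 AT; first by lia.
(* The boundary of [A] lies in a support of at most four vertices, so firing [A] puts chips on at
   least five vertices. *)
have dA4 := subset_leq_card (boundary_neq0 legA).
have [D2 [eqD2 D2_ge0 D2_neq0]] := fire_legal D1_ge0 legA.
apply: (icosa_no_spread D2_ge0 _ _ (positive_rank_equivalent eqD2 rkD1)).
  by rewrite (deg_equivalent eqD2).
apply: leq_trans (dA _) _; first by rewrite -/S in dA4; lia.
by apply/subset_leq_card/subsetP => w wB; rewrite inE D2_neq0.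
Qed.

Theorem theorem9 : is_gonality icosahedron 9.
Proof.
split=> [|M [D [<- rkD]]]; last exact: icosa_positive_rank_deg.
(* A largest independent set: three vertices, leaving 12 - 3 = 9 chips. *)
pose I : {set icosahedron} := [set ico_t; ico_w 0; ico_w 2%:R].
exists [ffun v => (v \notin I)%:Z]; split.
  have cardI : #|~: I| = 9%N.
    by rewrite card_icosa /I; under eq_count do rewrite !inE; vm_compute.
  rewrite -[RHS]/(9%N%:Z) -cardI -sum1_card (big_morph Posz PoszD (erefl _)).
  rewrite [RHS]big_mkcond; apply: eq_bigr => v _.
  by rewrite ffunE in_setC; case: (v \notin I).
apply: positive_rank_independent => [v|v w|v w]; last exact: icosa_simple.
  have [i i12 ->] := icosa_nthP v; rewrite /valence sum_icosa.
  by move: i i12; apply/allP; rewrite unlock; vm_compute.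
by rewrite !inE -!orbA => /or3P[]/eqP-> /or3P[]/eqP->.
Qed.
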